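(* Let $f(x)=\frac1x$. For Lebesgue-almost every $\alpha\in(0,1)$ it holds that $$\limsup_{N\to\infty}\frac{S_N^1(f)(\alpha)}{N\log(N)}>1\ge\liminf_{N\to\infty}\frac{S_N^1(f)(\alpha)}{N\log(N)}.$$
   Context: For irrational $\alpha\in(0,1)$, $R(x)=x+\alpha\pmod1$ on $[0,1)$, and $$S_N^1(f)(x)=\sum_{n=0}^{N-1}f(R^nx)-\max_{0\le n\le N-1}f(R^nx)$$ is the Birkhoff sum with the largest term removed. In the claim it is evaluated at the starting point $x=\alpha$, with rotation angle also $\alpha$. *)

(* Defs.v *)
From HB Require Import structures.
From mathcomp Require Import all_boot all_order all_algebra.
From mathcomp Require Import all_classical all_reals all_analysis.
Set Implicit Arguments.
Unset Strict Implicit.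
Unset Printing Implicit Defensive.
Import Order.TTheory GRing.Theory Num.Theory.
Local Open Scope ring_scope.

Definition rotation (R : realType) (alpha x : R) : R :=
  x + alpha - (Num.floor (x + alpha))%:~R.

(* The index n = 0 is always present when 0 < N, so taking f x, its term, as
   the neutral element of the iterated maximum gives the true maximum of the
   N terms, whatever the sign of f. The value at N = 0 is junk. *)
Definition trimmed_birkhoff_sum (R : realType) (alpha : R) (f : R -> R)
    (N : nat) (x : R) : R :=
  \sum_(0 <= n < N) f (iter n (rotation alpha) x)
  - \big[Num.max/f x]_(0 <= n < N) f (iter n (rotation alpha) x).

(* Main.v *)
Require Import Defs.
From HB Require Import structures.
From mathcomp Require Import all_boot all_order all_algebra.
From mathcomp Require Import all_classical all_reals all_analysis.
From mathcomp Require Import ring lra zify.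
Import Order.TTheory GRing.Theory Num.Theory.
Import numFieldNormedType.Exports.
Local Open Scope ring_scope.

(** Write {y} for the fractional part. The orbit of alpha is {n alpha}, n >= 1,
and both bounds come from very good rational approximations of alpha from
below: infinitely many coprime p, q with
  0 < alpha - p / q < 1 / (16 q^2 ln q).
That almost every alpha has them is the one-sided, divergent case of Khinchin's
theorem (never_log_close_null).

Upper limit (trimmed_sum_ratio_ge2). Put delta = {q alpha} = q alpha - p, so
that delta < 1 / (16 q ln q) and {2 q alpha} = 2 delta. Among the first N = 2q
terms of the sum two are at least 1 / (2 delta). Removing the largest term
leaves one of them, and 1 / (2 delta) > 8 q ln q is at least 2 N ln N. Hence the
upper limit is at least 2.

Lower limit (trimmed_sum_le). Take N = q - 1. As p / q lies below alpha by less
than 1 / q^2, for j < q the point {j alpha} lies above the fraction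
(j p mod q) / q. These numerators run over 1, ..., q - 1, so even the full sum
is at most q (1 + 1/2 + ... + 1/(q-1)) <= q (1 + ln N), which is asymptotic to
N ln N.

Khinchin's theorem. Let E be the set of points of [0, 1] without such an
approximation of denominator at least M, and suppose that E has measure at least
g > 0. Fix an integer B of size at least 136 / g and consider, for every l with
B^l >= M, the fractions with denominator in (B^l, B^(l+1)].
- By Dirichlet's theorem every point of E is within r = 1 / (B^l B^(l+1)) of
  such a fraction, unless it is very close to a fraction of denominator <= B^l;
  the exceptions have measure at most 4 / B.
- Let rho be the value of 1 / (16 q^2 ln q) at q = B^(l+1). By the choice of E,
  the interval (x, x + rho) to the right of such a fraction x avoids E. If x is
  within r of a point e of E and the interval at x meets one belonging to a
  smaller scale, then e is within 2 r of an endpoint of the latter, because e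
  does not belong to it (disjoint_intervals_of_gap). The points e with this
  property have measure at most 64 / B over all smaller scales together.
- So at least g / (4 r) fractions of scale l carry intervals that are disjoint
  from all those of smaller scales (fractions_near_set). They are also disjoint
  from each other, since distinct fractions of scale l are at least
  1 / B^(2l+2) > rho apart. Their total length is at least c / (l + 1), where c
  depends on g and B only.
The harmonic series diverges, whereas all these disjoint intervals lie in
(0, 2): a contradiction. *)

(** * Logarithm and harmonic sums *)

Lemma ln_succB_le (R : realType) (n : nat) :
  ln n.+2%:R - ln n.+1%:R <= n.+1%:R^-1 :> R.
Proof.
rewrite -ln_div ?posrE ?ltr0n //.
have -> : n.+2%:R / n.+1%:R = 1 + n.+1%:R^-1 :> R.
  by rewrite -[n.+2]addn1 natrD mulrDl divff ?pnatr_eq0 // mul1r.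
by apply: le_ln1Dx; apply: lt_trans (_ : 0 < _); rewrite ?ltrN10 // invr_gt0 ltr0n.
Qed.

Lemma ln_succB_ge (R : realType) (n : nat) :
  n.+2%:R^-1 <= ln n.+2%:R - ln n.+1%:R :> R.
Proof.
rewrite -lerN2 opprB -ln_div ?posrE ?ltr0n //.
have -> : n.+1%:R / n.+2%:R = 1 + - n.+2%:R^-1 :> R.
  have n0 : 0 < n.+2%:R :> R by rewrite ltr0n.
  have -> : n.+1%:R = n.+2%:R - 1 :> R by rewrite -[n.+2]addn1 natrD addrK.
  by field; rewrite gt_eqF.
by apply: le_ln1Dx; rewrite ltrN2 invf_lt1 ?ltr1n ?ltr0n.
Qed.

Lemma half_le_ln (R : realType) (n : nat) : (1 < n)%N -> 2^-1 <= ln n%:R :> R.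
Proof.
move=> n1; apply: (@le_trans _ _ (ln 2%:R)).
  by have := ln_succB_ge R 0; rewrite ln1 subr0.
by rewrite ler_ln ?posrE ?ltr0n ?ler_nat // ltnW.
Qed.

Lemma harmonic_le_ln (R : realType) (n : nat) :
  \sum_(i < n.+2) (i%:R : R)^-1 <= 1 + ln n.+1%:R.
Proof.
elim: n => [|n IHn].
  by rewrite !big_ord_recl big_ord0 /= invr0 ln1 invr1 add0r.
rewrite big_ord_recr /=.
have := ln_succB_ge R n; set S := \sum_(i < _) _ in IHn *.
move: IHn; set x := ln _; set y := ln _; set z := _^-1 => IHn.
lra.
Qed.

(** * Trimmed sums along the orbit *)

(** At least one of two distinct large terms survives the trimming. *)
Lemma sum_subr_max_ge (R : realDomainType) (a : nat -> R) (N i j : nat) (c : R) :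
  (forall n, 0 <= a n) -> (i < N)%N -> (j < N)%N -> i != j ->
  c <= a i -> c <= a j ->
  c <= \sum_(0 <= n < N) a n - \big[Num.max/a 0%N]_(0 <= n < N) a n.
Proof.
move=> a0 iN jN ij ci cj; rewrite lerBrDl.
(* given n, one of i and j differs from n and still contributes c to the sum *)
have key n : (n < N)%N -> a n <= \sum_(0 <= n < N) a n - c.
  move=> nN; have [k [kn kN ck]] : exists k, [/\ k != n, (k < N)%N & c <= a k].
    have [->|ni] := eqVneq n i; first by exists j; rewrite eq_sym.
    by exists i; rewrite eq_sym.
  rewrite lerBrDr big_mkord (bigD1 (Ordinal nN)) //= (bigD1 (Ordinal kN)) //=.
  rewrite addrA; apply: ler_wpDr; first exact: sumr_ge0.
  by rewrite lerD2l.
rewrite -lerBrDr big_seq; apply: bigmax_le => [|n].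
  by apply: key; apply: leq_ltn_trans iN.
by rewrite mem_index_iota => /andP[_ nN]; apply: key.
Qed.

Lemma iter_rotation (R : realType) (x : R) (n : nat) : 0 < x < 1 ->
  iter n (rotation x) x = n.+1%:R * x - (Num.floor (n.+1%:R * x))%:~R.
Proof.
move=> /andP[x0 x1]; elim: n => [|n IHn] /=.
  by rewrite mul1r (@floor_def _ x 0) ?subr0 //= ltW.
rewrite IHn /rotation.
set m := Num.floor (n.+1%:R * x).
have -> : n.+1%:R * x - m%:~R + x = n.+2%:R * x - m%:~R.
  by rewrite -[n.+2]addn1 natrD; ring.
by rewrite floorDrz ?rpredN ?intr_int // -intrN intrKfloor intrD intrN; ring.
Qed.

Definition fract (R : realType) (x : R) : R := x - (Num.floor x)%:~R.

Lemma fract_ge0 (R : realType) (x : R) : 0 <= fract R x.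
Proof. by rewrite /fract subr_ge0 floor_le. Qed.

Lemma fract_natD (R : realType) (m : nat) (y : R) :
  0 <= y < 1 -> fract R (m%:R + y) = y.
Proof.
move=> /andP[y0 y1]; rewrite /fract (@floor_def _ _ m%:Z); first by rewrite addrC addKr.
by rewrite intrD -pmulrn lerDl y0 ltrD2l.
Qed.

(** With j p = t q + i, one has j x = t + i / q + j (x - p / q). The last term
is in [0, 1/q) and i <= q - 1, so the integer part of j x is t. *)
Lemma fract_mul_ge (R : realType) (x : R) (p q j : nat) :
  0 <= x - p%:R / q%:R < (q%:R ^+ 2)^-1 -> (j < q)%N ->
  ((j * p) %% q)%:R / q%:R <= fract R (j%:R * x).
Proof.
move=> /andP[d0 d1] jq.
have q0 : (0 : R) < q%:R by rewrite ltr0n (leq_trans _ jq).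
set d := x - _ in d0 d1.
pose y : R := ((j * p) %% q)%:R / q%:R + j%:R * d.
have -> : j%:R * x = ((j * p) %/ q)%:R + y.
  have e : j%:R * p%:R = ((j * p) %/ q)%:R * q%:R + ((j * p) %% q)%:R :> R.
    by rewrite -!natrM -natrD -divn_eq.
  have -> : x = d + p%:R / q%:R by rewrite /d subrK.
  rewrite mulrDr mulrA e /y; field.
  by rewrite gt_eqF.
have jd0 : 0 <= j%:R * d by rewrite mulr_ge0.
have jd1 : j%:R * d < q%:R^-1.
  apply: (@le_lt_trans _ _ (q%:R * d)).
    by rewrite ler_wpM2r // ler_nat ltnW.
  by rewrite -ltr_pdivlMl // -expr2 exprVn.
have r1 : ((j * p) %% q)%:R / q%:R <= 1 - q%:R^-1 :> R.
  rewrite ler_pdivrMr // mulrBl mul1r mulVf ?gt_eqF // lerBrDr natr1 ler_nat.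
  by rewrite ltn_mod (leq_trans _ jq).
rewrite fract_natD /y ?lerDl //; apply/andP; split.
  by rewrite addr_ge0 // divr_ge0.
lra.
Qed.

(** Multiplication by p permutes the residues modulo q. The terms with residue 0
are harmless because the inverse of 0 is 0. *)
Lemma sum_inv_modn_mul (R : realType) (p q : nat) : coprime p q ->
  \sum_(j < q) (((j * p) %% q)%:R : R)^-1 = \sum_(j < q) (j%:R : R)^-1.
Proof.
case: q => [|q] cpq; first by rewrite !big_ord0.
pose h (j : 'I_q.+1) : 'I_q.+1 := inord ((j * p) %% q.+1).
have hE j : h j = ((j * p) %% q.+1)%N :> nat by rewrite inordK // ltn_mod.
have h_inj : injective h.
  suff le i j : h i = h j -> (i <= j)%N -> i = j.
    by move=> i j hij; have [/le->|/ltnW/le->] := leqP i j.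
  move=> /(congr1 val) /=; rewrite !hE => /eqP e ij; apply/val_inj/eqP => /=.
  move: e; rewrite eq_sym eqn_mod_dvd ?leq_mul2r ?ij ?orbT // -mulnBl.
  rewrite Gauss_dvdl ?[coprime q.+1 p]coprime_sym // -eqn_mod_dvd //.
  by rewrite !modn_small // eq_sym.
rewrite [RHS](reindex_inj h_inj) /=.
by apply: eq_bigr => j _; rewrite hE.
Qed.

(** With q = n + 2, the q - 1 points of the orbit dominate, one by one, the
nonzero multiples of 1 / q in [0, 1). *)
Lemma trimmed_sum_le (R : realType) (x : R) (p n : nat) : 0 < x < 1 ->
  coprime p n.+2 -> 0 <= x - p%:R / n.+2%:R < (n.+2%:R ^+ 2)^-1 ->
  trimmed_birkhoff_sum x (fun y : R => y^-1) n.+1 x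
    <= n.+2%:R * (1 + ln n.+1%:R).
Proof.
move=> x01 cpq xpq; rewrite /trimmed_birkhoff_sum.
set f := fun y : R => y^-1.
have f0 k : 0 <= f (iter k (rotation x) x).
  by rewrite iter_rotation // invr_ge0 fract_ge0.
apply: (@le_trans _ _ (\sum_(0 <= k < n.+1) f (iter k (rotation x) x))).
  rewrite gerBl; elim/big_ind: _ => //; first exact: f0 0%N.
  by move=> a b a0 b0; rewrite le_max a0.
apply: (@le_trans _ _ (n.+2%:R * \sum_(j < n.+2) (j%:R : R)^-1)); last first.
  by rewrite ler_pM2l ?ltr0n // harmonic_le_ln.
rewrite -(@sum_inv_modn_mul R p) // big_ord_recl /= mul0n mod0n invr0 add0r.
rewrite big_mkord mulr_sumr; apply: ler_sum => k _.
rewrite iter_rotation // -/(fract R _) /f.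
have kq : (k.+1 < n.+2)%N by rewrite ltnS ltn_ord.
have := fract_mul_ge R x p n.+2 k.+1 xpq kq.
rewrite /bump add1n; set r := (_ %% _)%N => rle.
have r0 : (0 < r)%N.
  rewrite lt0n; apply/negP => rd; suff : (n.+2 %| k.+1)%N.
    by move=> /dvdn_leq - /(_ isT); rewrite leqNgt kq.
  by rewrite -(@Gauss_dvdl _ _ p) // coprime_sym.
rewrite -[leRHS]invrK lef_pV2 ?posrE.
- by apply: le_trans rle; rewrite invfM invrK mulrC.
- by apply: lt_le_trans rle; rewrite divr_gt0 ?ltr0n.
- by rewrite invr_gt0 mulr_gt0 ?invr_gt0 ?ltr0n.
Qed.

(** Both the q-th and the 2q-th point of the orbit are within 2 (q x - p) of 0,
and only one of the two corresponding terms can be trimmed. *)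
Lemma trimmed_sum_ratio_ge2 (R : realType) (x : R) (p q : nat) : 0 < x < 1 ->
  (1 < q)%N -> 0 < x - p%:R / q%:R < (16 * q%:R ^+ 2 * ln q%:R)^-1 ->
  2 <= trimmed_birkhoff_sum x (fun y : R => y^-1) (q.*2) x
         / (q.*2%:R * ln q.*2%:R).
Proof.
move=> x01 q1 /andP[d0 d1].
have q0 : (0 : R) < q%:R by rewrite ltr0n ltnW.
have lq0 : (0 : R) < ln q%:R by rewrite ln_gt0 // ltr1n.
have l2q : ln q.*2%:R <= 2 * ln q%:R :> R.
  rewrite -mul2n natrM lnM ?posrE // mulr_natl mulr2n lerD2r ler_ln ?posrE //.
  by rewrite (ler_nat R 2 q).
have l2q0 : (0 : R) < ln q.*2%:R.
  by rewrite ln_gt0 // ltr1n -mul2n (leq_trans q1) // leq_pmull.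
(* e is the fractional part of q x *)
set d := x - _ in d0 d1; pose e : R := q%:R * d.
have e0 : 0 < e by rewrite mulr_gt0.
have e1 : e * (16 * q%:R * ln q%:R) < 1.
  move: d1; rewrite -div1r ltr_pdivlMr; last by rewrite !mulr_gt0 // exprn_gt0.
  by rewrite /e; set l := ln _; lra.
have xq : q%:R * x = p%:R + e by rewrite /e /d; field; rewrite gt_eqF.
have lq : 2^-1 <= ln q%:R :> R by exact: half_le_ln.
have e2 : 2 * e < 1.
  have q2 : 2 <= q%:R :> R by rewrite ler_nat.
  have : 1 <= q%:R * ln q%:R :> R.
    by apply: le_trans (ler_pM _ _ q2 lq); rewrite ?invr_ge0 // divff.
  by set l := q%:R * _; rewrite -mulrA -/l in e1 *; nra.
have fq : fract R (q%:R * x) = e by rewrite xq fract_natD // ltW //=; lra.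
have f2q : fract R (q.*2%:R * x) = 2 * e.
  rewrite -mul2n natrM -mulrA xq mulrDr -natrM fract_natD // mulr_ge0 ?ltW //.
rewrite ler_pdivlMr; last by rewrite mulr_gt0 // ltr0n double_gt0 ltnW.
apply: (@le_trans _ _ (2 * e)^-1).
  rewrite -div1r ler_pdivlMr ?mulr_gt0 //.
  apply: le_trans (ltW e1); rewrite -[X in ln X]/(q.*2%:R) -[X in X%:R * ln _]mul2n natrM.
  have := ler_wpM2l (mulr_ge0 (ltW q0) (ltW e0)) l2q.
  by set l2 := ln _; set l := ln _; lra.
apply: (@sum_subr_max_ge R (fun n => (iter n (rotation x) x)^-1) _ q.-1 q.*2.-1).
- by move=> n; rewrite iter_rotation // invr_ge0 fract_ge0.
- by move: q1; clear; lia.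
- by move: q1; clear; lia.
- by move: q1; clear; lia.
- rewrite iter_rotation // prednK ?(ltnW q1) // -/(fract R _) fq.
  by rewrite lef_pV2 ?posrE ?mulr_gt0 //; lra.
- by rewrite iter_rotation // prednK ?double_gt0 ?(ltnW q1) // -/(fract R _) f2q.
Qed.

(** * Rational approximation *)

(** Pigeonhole on the fractional parts of 0, x, ..., Q x in Q boxes of length
1 / Q. Reducing the resulting fraction to lowest terms only lowers its
denominator, hence keeps the bound. *)
Lemma dirichlet_coprime (R : realType) (x : R) (Q : nat) : 0 <= x <= 1 -> (0 < Q)%N ->
  exists p q : nat, [/\ coprime p q, (0 < q <= Q)%N, (p <= q)%N
    & `|x - p%:R / q%:R| < (q%:R * Q%:R)^-1].
Proof.
move=> /andP[x0 x1] Q0.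
have Q0R : (0 : R) < Q%:R by rewrite ltr0n.
pose t (j : nat) := Num.truncn (j%:R * x).
pose fr (j : nat) : R := j%:R * x - (t j)%:R.
have tP j : (t j)%:R <= j%:R * x < (t j).+1%:R by apply: truncn_itv; rewrite mulr_ge0.
have fr0 j : 0 <= fr j by rewrite subr_ge0; case/andP: (tP j).
have fr1 j : fr j < 1 by rewrite ltrBlDl natr1; case/andP: (tP j).
have bound j : (Num.truncn (Q%:R * fr j) < Q)%N.
  by rewrite truncn_lt_nat ?mulr_ge0 // gtr_pMr.
pose box (j : 'I_Q.+1) : 'I_Q := Ordinal (bound j).
have /injectivePn[i0 [j0 ij0 eij0]] : ~~ injectiveb box.
  by apply/negP => /injectiveP /leq_card; rewrite !card_ord ltnn.
have {ij0 eij0}[i [j [ij jQ eij]]] : exists i j : nat,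
    [/\ (i < j)%N, (j <= Q)%N & Num.truncn (Q%:R * fr i) = Num.truncn (Q%:R * fr j)].
  have bij : Num.truncn (Q%:R * fr i0) = Num.truncn (Q%:R * fr j0) := congr1 val eij0.
  have [lt|lt|/val_inj e] := ltngtP i0 j0; last by rewrite e eqxx in ij0.
    by exists i0, j0; split; first exact: lt; first exact: (ltn_ord j0).
  by exists j0, i0; split; first exact: lt; first exact: (ltn_ord i0).
pose d := (j - i)%N; pose P := (t j - t i)%N.
have d0 : (0 < d)%N by rewrite subn_gt0.
have d0R : (0 : R) < d%:R by rewrite ltr0n.
have tij : (t i <= t j)%N by apply: le_truncn; rewrite ler_wpM2r // ler_nat ltnW.
have dP : `|d%:R * x - P%:R| < Q%:R^-1.
  have -> : d%:R * x - P%:R = fr j - fr i.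
    by rewrite /d /P (natrB R (ltnW ij)) (natrB R tij) /fr; ring.
  rewrite -div1r ltr_pdivlMr // -(gtr0_norm Q0R) -normrM mulrBl ![_ * Q%:R]mulrC.
  have /andP[i1 i2] := truncn_itv (mulr_ge0 (ltW Q0R) (fr0 i)).
  have /andP[j1 j2] := truncn_itv (mulr_ge0 (ltW Q0R) (fr0 j)).
  move: i1 i2 j1 j2; rewrite eij -natr1.
  by set m := Num.truncn _; set u := _ * fr i; set v := _ * fr j; rewrite ltr_norml; lra.
have Pd : (P <= d)%N.
  rewrite -ltnS -(ltr_nat R) -natr1.
  have : P%:R - d%:R * x < 1.
    apply: le_lt_trans (lt_le_trans dP _); first by rewrite distrC ler_norm.
    by rewrite invf_le1 // ler1n.
  have : d%:R * x <= d%:R by rewrite ler_piMr.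
  lra.
pose g := gcdn P d; have g0 : (0 < g)%N by rewrite gcdn_gt0 d0 orbT.
exists (P %/ g)%N, (d %/ g)%N.
have qd : (d %/ g <= d)%N by exact: leq_div.
have q0 : (0 < d %/ g)%N by rewrite divn_gt0 // dvdn_leq // dvdn_gcdr.
have q0R : (0 : R) < (d %/ g)%:R by rewrite ltr0n.
split.
- rewrite /coprime -(eqn_pmul2r g0) mul1n muln_gcdl !divnK ?dvdn_gcdl ?dvdn_gcdr //.
- by rewrite q0 (leq_trans qd) // (leq_trans (leq_subr _ _)).
- by rewrite leq_div2r.
have -> : (P %/ g)%:R / (d %/ g)%:R = P%:R / d%:R :> R.
  apply/eqP; rewrite (eqr_div _ _ (lt0r_neq0 q0R) (lt0r_neq0 d0R)) -!natrM eqr_nat.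
  by rewrite -{1}[d](@divnK g) ?dvdn_gcdr // -[X in _ == (X * _)%N](@divnK g) ?dvdn_gcdl // mulnCA mulnC.
have -> : x - P%:R / d%:R = d%:R^-1 * (d%:R * x - P%:R).
  by field; rewrite gt_eqF.
rewrite normrM gtr0_norm ?invr_gt0 //.
apply: (@lt_le_trans _ _ (d%:R^-1 * Q%:R^-1)); first by rewrite ltr_pM2l ?invr_gt0.
by rewrite -invfM lef_pV2 ?posrE ?mulr_gt0 // ler_pM2r // ler_nat.
Qed.

(** Their difference is a nonzero integer divided by q q'. *)
Lemma fractions_separated (R : realType) (p q p' q' Q : nat) :
  (0 < q <= Q)%N -> (0 < q' <= Q)%N -> p%:R / q%:R != p'%:R / q'%:R :> R ->
  (Q%:R ^+ 2)^-1 <= `|p%:R / q%:R - p'%:R / q'%:R| :> R.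
Proof.
move=> /andP[q0 qQ] /andP[q'0 q'Q].
have q0R : (0 : R) < q%:R by rewrite ltr0n.
have q'0R : (0 : R) < q'%:R by rewrite ltr0n.
rewrite (eqr_div _ _ (lt0r_neq0 q0R) (lt0r_neq0 q'0R)) -!natrM eqr_nat => ne.
have -> : p%:R / q%:R - p'%:R / q'%:R
    = ((p * q')%N%:R - (p' * q)%N%:R) / (q * q')%N%:R :> R.
  by rewrite !natrM; field; rewrite !gt_eqF.
rewrite normrM normfV [`|(q * q')%:R|]ger0_norm //.
apply: (@le_trans _ _ (1 / (q * q')%:R)).
  rewrite mul1r lef_pV2 ?posrE ?exprn_gt0 ?ltr0n ?muln_gt0 ?q0 ?q'0 ?(leq_trans q0 qQ) //.
  by rewrite -natrX ler_nat -mulnn leq_mul.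
rewrite ler_wpM2r // !pmulrn -intrB -intr_norm ler1z.
by rewrite -gtz0_ge1 normr_gt0 subr_eq0.
Qed.

(** * Lebesgue measure of finite unions of intervals *)

Lemma mem_bigsetU (I : choiceType) (T : Type) (s : seq I) (A : I -> set T) (y : T) :
  (\big[setU/set0]_(i <- s) A i)%classic y <-> exists2 i, i \in s & A i y.
Proof. by rewrite -bigcup_seq; split=> -[i /= iS Ai]; exists i. Qed.

Lemma lebesgue_measure_oo (R : realType) (a b : R) : a <= b ->
  lebesgue_measure (`]a, b[%classic : set R) = (b - a)%:E.
Proof.
rewrite le_eqVlt => /orP[/eqP->|ab]; first by rewrite set_itvoo0 // measure0 subrr.
by rewrite lebesgue_measure_itv /= lte_fin ab.
Qed.

Lemma lebesgue_measure_bigsetU_le (R : realType) (I : eqType) (s : seq I)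
    (A : I -> set R) (c : I -> R) :
  (forall i, i \in s -> measurable (A i)) ->
  (forall i, i \in s -> (lebesgue_measure (A i) <= (c i)%:E)%E) ->
  (lebesgue_measure (\big[setU/set0]_(i <- s) A i) <= (\sum_(i <- s) c i)%:E)%E.
Proof.
elim: s => [|i s IHs] mA cA; first by rewrite !big_nil measure0.
have mem j : j \in s -> j \in i :: s by rewrite inE => ->; rewrite orbT.
rewrite !big_cons EFinD; apply: le_trans (measureU2 _ _ _) _.
- by apply: mA; rewrite mem_head.
- rewrite big_seq; apply: bigsetU_measurable => j js; exact: mA (mem _ js).
by apply: leeD; [apply: cA; rewrite mem_head|
  apply: IHs => j js; [apply: mA (mem _ js)|apply: cA (mem _ js)]].
Qed.

Lemma lebesgue_measure_separated (R : realType) (s : seq R) (rho : R) : 0 <= rho ->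
  uniq s -> {in s &, forall x y, x != y -> rho <= `|x - y|} ->
  lebesgue_measure (\big[setU/set0]_(x <- s) `]x, x + rho[%classic) = ((size s)%:R * rho)%:E.
Proof.
move=> rho0; elim: s => [|x s IHs] /=; first by rewrite big_nil measure0 mul0r.
move=> /andP[xs us] sep; rewrite big_cons.
have mem y : y \in s -> y \in x :: s by rewrite inE => ->; rewrite orbT.
rewrite measureU //=.
- rewrite lebesgue_measure_oo ?lerDl // IHs //; last first.
    by move=> y z ys zs; apply: sep; exact: mem.
  by rewrite -EFinD; congr EFin; rewrite -natr1; ring.
- by apply: bigsetU_measurable => y _.
rewrite -subset0 => y [/= xy /mem_bigsetU[z zs /=]]; move: xy.
rewrite !in_itv /= => /andP[xy xy'] /andP[zy zy'].
have xz : x != z by apply: contraNneq xs => ->.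
have := sep x z (mem_head _ _) (mem _ zs) xz.
by apply/negP; rewrite -ltNge ltr_norml; lra.
Qed.

(** * Neighbourhoods of fractions *)

(** The denominator 0 is included; it only contributes the value 0. *)
Definition fractions (R : realType) (Q : nat) : seq R :=
  [seq p%:R / q%:R | p <- iota 0 Q.+1, q <- iota 0 Q.+1].

(** The points whose Dirichlet approximation at height Q' may have a denominator
that is at most Q. *)
Definition near_small_fractions (R : realType) (Q Q' : nat) : set R :=
  \big[setU/set0]_(q <- iota 1 Q) \big[setU/set0]_(p <- iota 0 q.+1)
    ball (p%:R / q%:R : R) (q%:R * Q'%:R)^-1.

(** Neighbourhoods of both endpoints of the intervals ]x, x + rho k[ attached to
the fractions x of the scales k < l; scale k has denominators up to B^(k+1). *)
Definition near_endpoints (R : realType) (B l : nat) (rho : nat -> R) (r : R) : set R :=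
  \big[setU/set0]_(k <- iota 0 l) \big[setU/set0]_(x <- fractions R (B ^ k.+1))
    (ball x (2 * r) `|` ball (x + rho k) (2 * r))%classic.

Lemma measurable_near_small_fractions (R : realType) (Q Q' : nat) :
  measurable (near_small_fractions R Q Q').
Proof.
by do 2! apply: bigsetU_measurable => ? _; exact: measurable_realfun.measurable_ball.
Qed.

Lemma measurable_near_endpoints (R : realType) (B l : nat) (rho : nat -> R) (r : R) :
  measurable (near_endpoints R B l rho r).
Proof.
do 2! apply: bigsetU_measurable => ? _.
by apply: measurableU; exact: measurable_realfun.measurable_ball.
Qed.

Lemma measure_near_small_fractions (R : realType) (Q Q' : nat) : (0 < Q')%N ->
  (lebesgue_measure (near_small_fractions R Q Q') <= (4 * Q%:R / Q'%:R)%:E)%E.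
Proof.
move=> Q'0; have Q'0R : (0 : R) < Q'%:R by rewrite ltr0n.
have -> : 4 * Q%:R / Q'%:R = \sum_(q <- iota 1 Q) (4 / Q'%:R) :> R.
  rewrite big_const_seq count_predT size_iota iter_addr_0 -[RHS]mulr_natl; ring.
apply: lebesgue_measure_bigsetU_le => q; rewrite mem_iota => /andP[q0 _].
  by apply: bigsetU_measurable => ? _; exact: measurable_realfun.measurable_ball.
have q0R : (0 : R) < q%:R by rewrite ltr0n.
apply: (@le_trans _ _ (\sum_(p <- iota 0 q.+1) (2 / (q%:R * Q'%:R)) : R)%:E).
  apply: lebesgue_measure_bigsetU_le => p _; first exact: measurable_realfun.measurable_ball.
  rewrite lebesgue_measure_ball ?invr_ge0 ?mulr_ge0 // lee_fin.
  by rewrite -[leLHS]mulr_natl.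
rewrite lee_fin big_const_seq count_predT size_iota iter_addr_0.
have h : q.+1%:R / q%:R <= 2 :> R.
  by rewrite ler_pdivrMr // -natr1; have : 1 <= q%:R :> R; [rewrite ler1n|lra].
have -> : 4 / Q'%:R = 2 * (2 / Q'%:R) :> R by ring.
have -> : (2 / (q%:R * Q'%:R)) *+ q.+1 = (q.+1%:R / q%:R) * (2 / Q'%:R) :> R.
  by rewrite -[LHS]mulr_natl invfM; ring.
by rewrite ler_wpM2r // divr_ge0.
Qed.

(** (B^k)^2 at least quadruples from one k to the next, so the last term
dominates the sum. *)
Lemma sum_sqr_geometric_le (B l : nat) : (1 < B)%N ->
  (\sum_(k <- iota 0 l) (B ^ k.+1).+1 ^ 2 <= 8 * (B ^ l) ^ 2)%N.
Proof.
move=> B1; elim: l => [|l IHl]; first by rewrite big_nil.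
rewrite -addn1 iotaD big_cat big_seq1 /= add0n addn1.
have : (0 < B ^ l)%N by rewrite expn_gt0 ltnW.
move: IHl; rewrite (expnS B l); set s := \sum_(_ <- _) _; set b := (B ^ l)%N.
have : (2 * b <= B * b)%N by rewrite leq_mul2r B1 orbT.
rewrite -!mulnn; set c := (B * b)%N; clear; nia.
Qed.

Lemma measure_near_endpoints (R : realType) (B l : nat) (rho : nat -> R) (r : R) :
  (1 < B)%N -> 0 <= r ->
  (lebesgue_measure (near_endpoints R B l rho r) <= (64 * (B ^ l)%:R ^+ 2 * r)%:E)%E.
Proof.
move=> B1 r0.
apply: (@le_trans _ _ (\sum_(k <- iota 0 l) (((B ^ k.+1).+1 ^ 2)%N%:R * (8 * r)) : R)%:E).
  apply: lebesgue_measure_bigsetU_le => k _.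
    by apply: bigsetU_measurable => ? _; apply: measurableU; exact: measurable_realfun.measurable_ball.
  have -> : ((B ^ k.+1).+1 ^ 2)%N%:R * (8 * r)
      = \sum_(x <- fractions R (B ^ k.+1)) (8 * r).
    rewrite big_const_seq count_predT /fractions size_allpairs !size_iota.
    by rewrite iter_addr_0 mulrC mulr_natr.
  apply: lebesgue_measure_bigsetU_le => x _.
    by apply: measurableU; exact: measurable_realfun.measurable_ball.
  have mball (a : R) : lebesgue_measure (ball a (2 * r)) = (4 * r)%:E.
    by rewrite lebesgue_measure_ball ?mulr_ge0 // -[X in X%:E]mulr_natl mulrA -natrM.
  apply: (@le_trans _ _ ((4 * r)%:E + (4 * r)%:E)%E).
    rewrite -{1}(mball x) -(mball (x + rho k)).
    by apply: measureU2; exact: measurable_realfun.measurable_ball.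
  by rewrite -EFinD lee_fin; lra.
rewrite lee_fin -mulr_suml -natr_sum.
have : (\sum_(k <- iota 0 l) (B ^ k.+1).+1 ^ 2)%N%:R <= (8 * (B ^ l) ^ 2)%N%:R :> R.
  by rewrite ler_nat sum_sqr_geometric_le.
rewrite natrM natrX => h.
have -> : 64 * (B ^ l)%:R ^+ 2 * r = 8 * (B ^ l)%:R ^+ 2 * (8 * r) by ring.
by apply: ler_wpM2r h; rewrite mulr_ge0.
Qed.

Lemma lebesgue_measure_cover3 (R : realType) (E A1 A2 A3 : set R) (a1 a2 a3 : R) :
  measurable E -> measurable A1 -> measurable A2 -> measurable A3 ->
  (E `<=` A1 `|` (A2 `|` A3))%classic ->
  (lebesgue_measure A1 <= a1%:E)%E -> (lebesgue_measure A2 <= a2%:E)%E ->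
  (lebesgue_measure A3 <= a3%:E)%E ->
  (lebesgue_measure E <= (a1 + (a2 + a3))%:E)%E.
Proof.
move=> mE m1 m2 m3 cover h1 h2 h3.
have m23 : measurable (A2 `|` A3)%classic by exact: measurableU.
apply: (@le_trans _ _ (lebesgue_measure (A1 `|` (A2 `|` A3))%classic)).
  by apply: le_measure; rewrite ?inE //; exact: measurableU.
rewrite EFinD; apply: le_trans (measureU2 _ _ _) _ => //; apply: leeD => //.
by rewrite EFinD; apply: le_trans (measureU2 _ _ _) _ => //; exact: leeD.
Qed.

(** * Khinchin's theorem, one-sided divergent case *)

(** Removing from E the neighbourhoods of the fractions of small denominator
(measure at most 4 / B) and of the earlier endpoints (at most 64 / B) leaves at
least half of its measure, since 136 = 2 (4 + 64). By Dirichlet's theorem the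
rest is covered by the balls of radius r centred at the fractions s. *)
Lemma fractions_near_set (R : realType) (E : set R) (g : R) (B l : nat) (rho : nat -> R) :
  measurable E -> (E `<=` [set x | (0 <= x <= 1)%R])%classic ->
  (g%:E <= lebesgue_measure E)%E -> (1 < B)%N -> 136 <= g * B%:R ->
  let r := ((B ^ l)%:R * (B ^ l.+1)%:R)^-1 in
  exists s : seq R, [/\ uniq s,
    forall x, x \in s -> exists p q : nat,
      [/\ coprime p q, (B ^ l < q <= B ^ l.+1)%N, (p <= q)%N & x = p%:R / q%:R],
    forall x, x \in s -> exists e,
      [/\ E e, `|x - e| < r & ~ near_endpoints R B l rho r e]
    & g / 2 <= (size s)%:R * (2 * r)].
Proof.
move=> mE E01 gE B1 gB r.
have BR0 : (0 : R) < B%:R by rewrite ltr0n ltnW.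
have Bl0 : (0 : R) < (B ^ l)%:R by rewrite ltr0n expn_gt0 ltnW.
have BS : (B ^ l.+1)%:R = B%:R * (B ^ l)%:R :> R by rewrite expnS natrM.
have BS0 : (0 : R) < (B ^ l.+1)%:R by rewrite BS mulr_gt0.
have r0 : 0 < r by rewrite invr_gt0 mulr_gt0.
have wide q : (B ^ l < q)%N -> (q%:R * (B ^ l.+1)%:R)^-1 <= r.
  move=> lq; have q0 : (0 : R) < q%:R by rewrite ltr0n (leq_ltn_trans _ lq).
  rewrite lef_pV2 ?posrE ?mulr_gt0 //.
  by rewrite (ler_pM2r BS0) ler_nat ltnW.
pose fine_fraction x := exists p q : nat,
  [/\ coprime p q, (B ^ l < q <= B ^ l.+1)%N, (p <= q)%N & x = p%:R / q%:R :> R].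
pose near_E x := exists e, [/\ E e, `|x - e| < r & ~ near_endpoints R B l rho r e].
pose s := undup [seq x <- fractions R (B ^ l.+1) | `[< fine_fraction x /\ near_E x >]].
have sP x : x \in s -> fine_fraction x /\ near_E x.
  by rewrite mem_undup mem_filter => /andP[/asboolP].
exists s; split; first exact: undup_uniq.
- by move=> x /sP[].
- by move=> x /sP[].
have cover : (E `<=` near_small_fractions R (B ^ l) (B ^ l.+1) `|`
    (near_endpoints R B l rho r `|` \big[setU/set0]_(x <- s) ball (x : R) r))%classic.
  move=> e Ee; have Q0 : (0 < B ^ l.+1)%N by rewrite expn_gt0 ltnW.
  have [p [q [cpq /andP[q0 qQ] pq epq]]] := @dirichlet_coprime R e _ (E01 _ Ee) Q0.
  have [qsmall|qbig] := leqP q (B ^ l).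
    left; apply/mem_bigsetU; exists q; first by rewrite mem_iota add1n q0 ltnS.
    apply/mem_bigsetU; exists p; first by rewrite mem_iota add0n ltnS.
    by rewrite -ball_normE /= distrC.
  right; have [near|far] := pselect (near_endpoints R B l rho r e); first by left.
  right; apply/mem_bigsetU; exists (p%:R / q%:R).
    rewrite mem_undup mem_filter; apply/andP; split.
      apply/asboolP; split; first by exists p, q; rewrite qbig.
      by exists e; split => //; rewrite distrC; exact: lt_le_trans epq (wide q qbig).
    apply/allpairsP; exists (p, q); split => //; rewrite mem_iota add0n ltnS //=.
    by rewrite (leq_trans pq).
  by rewrite -ball_normE /= distrC; exact: lt_le_trans epq (wide q qbig).
have small := @measure_near_small_fractions R (B ^ l) (B ^ l.+1) (ltac:(by rewrite expn_gt0 ltnW)).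
have ends := @measure_near_endpoints R B l rho r B1 (ltW r0).
have balls : (lebesgue_measure (\big[setU/set0]_(x <- s) ball (x : R) r)
    <= ((size s)%:R * (2 * r))%:E)%E.
  have -> : (size s)%:R * (2 * r) = \sum_(x <- s) (2 * r).
    by rewrite big_const_seq count_predT iter_addr_0 -[RHS]mulr_natl.
  apply: lebesgue_measure_bigsetU_le => x _; first exact: measurable_realfun.measurable_ball.
  by rewrite (lebesgue_measure_ball _ (ltW r0)) lee_fin -[leLHS]mulr_natl.
have mballs : measurable (\big[setU/set0]_(x <- s) ball (x : R) r).
  by apply: bigsetU_measurable => x _; exact: measurable_realfun.measurable_ball.
have := le_trans gE (lebesgue_measure_cover3 _ _ _ _ _ _ _ _ mE
  (measurable_near_small_fractions _ _ _) (measurable_near_endpoints _ _ _ _ _)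
  mballs cover small ends balls).
rewrite lee_fin.
have -> : 4 * (B ^ l)%:R / (B ^ l.+1)%:R = 4 / B%:R :> R.
  by rewrite BS; field; rewrite !gt_eqF.
have -> : 64 * (B ^ l)%:R ^+ 2 * r = 64 / B%:R.
  by rewrite /r BS; field; rewrite !gt_eqF.
have : 4 / B%:R + 64 / B%:R <= g / 2.
  rewrite -mulrDl ler_pdivrMr //; lra.
lra.
Qed.

(** If the two intervals met, then e, being within r of x but outside
]x', x' + rho'[, would be within 2 r of x' or of x' + rho'. *)
Lemma disjoint_intervals_of_gap (R : realType) (x x' r rho rho' e : R) :
  rho <= r -> `|x - e| < r -> ~ ball x' (2 * r) e -> ~ ball (x' + rho') (2 * r) e ->
  ~ (x' < e < x' + rho') ->
  (`]x, x + rho[ `&` `]x', x' + rho'[ = set0 :> set R)%classic.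
Proof.
rewrite -!ball_normE /= => rhor /ltr_normlP[xe1 xe2] /negP e1 /negP e2 /negP e3.
rewrite -subset0 => y /=; rewrite !in_itv /= => -[/andP[y1 y2] /andP[y3 y4]].
move: e1 e2 e3; rewrite -!leNgt negb_and -!leNgt !ler_normr.
by move=> /orP[] e1 /orP[] e2 /orP[] e3; suff : False by []; lra.
Qed.

Definition never_log_close (R : realType) (C : R) (N : nat) : set R :=
  [set x | 0 <= x <= 1 /\ forall p q : nat, coprime p q -> (N <= q)%N ->
     ~ (p%:R / q%:R < x < p%:R / q%:R + (C * q%:R ^+ 2 * ln q%:R)^-1)].

Lemma measurable_never_log_close (R : realType) (C : R) (N : nat) :
  measurable (never_log_close R C N).
Proof.
pose I p q : set R := if coprime p q && (N <= q)%N
  then `]p%:R / q%:R, p%:R / q%:R + (C * q%:R ^+ 2 * ln q%:R)^-1[%classic else set0.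
have -> : never_log_close R C N = (`[0, 1] `\` \bigcup_p \bigcup_q I p q)%classic.
  apply/seteqP; split=> [x [x01 far]|x [x01 far]].
    split; first by rewrite /= in_itv.
    move=> [p _ [q _]]; rewrite /I; case: ifP => // /andP[cpq Nq].
    by rewrite /= in_itv => /(far p q cpq Nq).
  split; first by move: x01; rewrite /= in_itv.
  move=> p q cpq Nq xpq; apply: far; exists p => //; exists q => //.
  by rewrite /I cpq Nq /= in_itv.
apply: measurableD => //; do 2! apply: bigcup_measurable => ? _.
by rewrite /I; case: ifP.
Qed.

(** The values of rho l at the denominators B^(l+1) form, up to the factor
1 / B^(2l+2), a harmonic series, because ln (B^(l+1)) = (l + 1) ln B. This is
where the divergence comes from; the scales being geometric, the fractions of all
the earlier scales together are still few compared with those of scale l. *)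
Lemma never_log_close_null (R : realType) (C : R) (N : nat) : 2 <= C ->
  lebesgue_measure (never_log_close R C N) = 0%E.
Proof.
move=> C2; have C0 : 0 < C by lra.
set E := never_log_close R C N.
have mE : measurable E by exact: measurable_never_log_close.
apply/eqP; rewrite eq_le measure_ge0 andbT leNgt; apply/negP => E_gt0.
have [g [g0 gE]] : exists g : R, 0 < g /\ (g%:E <= lebesgue_measure E)%E.
  case: (lebesgue_measure E) E_gt0 => [g g0|_|//]; first by exists g.
  by exists 1; rewrite leey.
have [B [B1 gB]] : exists B : nat, (1 < B)%N /\ 136 <= g * B%:R.
  exists (Num.truncn (136 / g)).+2; split => //.
  rewrite mulrC -ler_pdivrMr // ltW //.
  have /andP[_ /lt_le_trans] := truncn_itv (ltW (divr_gt0 (ltr0n R 136) g0)).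
  by apply; rewrite ler_nat.
have BR0 : (0 : R) < B%:R by rewrite ltr0n ltnW.
have lnB : 2^-1 <= ln B%:R :> R by exact: half_le_ln.
have lnB0 : 0 < ln B%:R :> R by apply: lt_le_trans lnB; rewrite invr_gt0.
have Q0 l : (0 : R) < (B ^ l)%:R by rewrite ltr0n expn_gt0 ltnW.
have QS l : (B ^ l.+1)%:R = B%:R * (B ^ l)%:R :> R by rewrite expnS natrM.
have lnQ l : ln (B ^ l.+1)%:R = l.+1%:R * ln B%:R :> R.
  by rewrite natrX lnXn // -[LHS]mulr_natl.
pose rho l : R := (C * (B ^ l.+1)%:R ^+ 2 * ln (B ^ l.+1)%:R)^-1.
have rho0 l : 0 < rho l.
  by rewrite invr_gt0 !mulr_gt0 ?exprn_gt0 // lnQ mulr_gt0 // ltr0n.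
have rho_sep l : rho l <= ((B ^ l.+1)%:R ^+ 2)^-1.
  rewrite lef_pV2 ?posrE ?exprn_gt0 //; last by rewrite -invr_gt0 rho0.
  rewrite mulrAC; apply: ler_peMl; first by rewrite exprn_ge0 // ltW.
  rewrite lnQ.
  have t1 : 1 <= l.+1%:R :> R by rewrite ler1n.
  apply: le_trans (ler_pM _ _ C2 (ler_pM _ _ t1 lnB)); rewrite ?mulr_ge0 ?invr_ge0 //.
  by rewrite mul1r divff.
pose r l : R := ((B ^ l)%:R * (B ^ l.+1)%:R)^-1.
have rho_r l : rho l <= r l.
  apply: le_trans (rho_sep l) _.
  rewrite lef_pV2 ?posrE ?exprn_gt0 ?mulr_gt0 // expr2 (ler_pM2r (Q0 _)).
  by rewrite ler_nat leq_exp2l.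
have rho1 l : rho l <= 1.
  apply: le_trans (rho_sep l) _.
  by rewrite invf_le1 ?exprn_gt0 // exprn_ege1 // ler1n expn_gt0 (ltnW B1).
have [s sP] := choice (fun l => fractions_near_set R E g B l rho mE
  (fun x => @proj1 _ _) gE B1 gB).
pose U l : set R := (\big[setU/set0]_(x <- s l) `]x, x + rho l[)%classic.
have mU l : measurable (U l) by apply: bigsetU_measurable => ? _.
(* The constant is (g / 2) * (rho l / (2 * r l)) * (l + 1), which does not
   depend on l. *)
pose c := g / (4 * C * B%:R * ln B%:R).
have c0 : 0 < c by rewrite divr_gt0 // !mulr_gt0.
have muU l : ((c / l.+1%:R)%:E <= lebesgue_measure (U l))%E.
  have [us sfr _ ssize] := sP l.
  rewrite (@lebesgue_measure_separated R (s l) (rho l) (ltW (rho0 l)) us); last first.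
    move=> x y xs ys; have [p [q [_ /andP[q1 q2] _ ->]]] := sfr x xs.
    have [p' [q' [_ /andP[q1' q2'] _ ->]]] := sfr y ys.
    move=> ne; apply: le_trans (rho_sep l) _; apply: fractions_separated ne.
      by rewrite q2 (leq_ltn_trans _ q1).
    by rewrite q2' (leq_ltn_trans _ q1').
  rewrite lee_fin.
  have -> : c / l.+1%:R = g / 2 * (rho l / (2 * r l)).
    rewrite /c /rho /r lnQ QS; field.
    by rewrite !gt_eqF //= ?ltr0n.
  have -> : (size (s l))%:R * rho l = (size (s l))%:R * (2 * r l) * (rho l / (2 * r l)).
    by rewrite /r; field; rewrite !gt_eqF.
  by apply: ler_wpM2r ssize; rewrite divr_ge0 ?mulr_ge0 ?ltW // invr_gt0 mulr_gt0.
have disjU k l : (N <= k)%N -> (k < l)%N -> (U k `&` U l = set0)%classic.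
  move=> Nk kl; rewrite -subset0 => y [/mem_bigsetU[x' x's yx'] /mem_bigsetU[x xs yx]].
  have [_ fr_l near_l _] := sP l; have [_ fr_k _ _] := sP k.
  have [e [Ee xe far]] := near_l x xs.
  have [p [q [cpq /andP[q1 q2] pq ex']]] := fr_k x' x's.
  have Nq : (N <= q)%N.
    by apply: leq_trans (leq_trans Nk _) (ltnW q1); exact/ltnW/ltn_expl.
  have far' : ~ (ball x' (2 * r l) `|` ball (x' + rho k) (2 * r l))%classic e.
    move=> ne; apply: far; apply/mem_bigsetU; exists k; first by rewrite mem_iota add0n.
    apply/mem_bigsetU; exists x' => //; apply/allpairsP; exists (p, q).
    by split => //; rewrite mem_iota add0n ltnS //= (leq_trans pq).
  have e_out : ~ (x' < e < x' + rho k).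
    rewrite ex' => /andP[e1 e2]; apply: (proj2 Ee p q cpq Nq).
    rewrite e1 (lt_le_trans e2) // lerD2l.
    have q_gt1 : (1 < q)%N by apply: leq_ltn_trans q1; rewrite expn_gt0 ltnW.
    have q0 : (0 : R) < q%:R by rewrite ltr0n ltnW.
    have lnq0 : (0 : R) < ln q%:R by rewrite ln_gt0 // ltr1n.
    have den0 : 0 < C * q%:R ^+ 2 * ln q%:R by rewrite !mulr_gt0 ?exprn_gt0.
    have denk0 : 0 < C * (B ^ k.+1)%:R ^+ 2 * ln (B ^ k.+1)%:R.
      by rewrite -invr_gt0; exact: rho0.
    have qQ : q%:R <= (B ^ k.+1)%:R :> R by rewrite ler_nat.
    rewrite lef_pV2 ?posrE //; apply: ler_pM.
    - by rewrite mulr_ge0 ?exprn_ge0 ?(ltW C0).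
    - exact: ltW.
    - by rewrite (ler_pM2l C0); apply: lerXn2r; rewrite ?nnegrE ?ler0n.
    - by rewrite ler_ln ?posrE.
  have dis := @disjoint_intervals_of_gap R x x' (r l) (rho l) (rho k) e (rho_r l) xe
    (fun h => far' (or_introl h)) (fun h => far' (or_intror h)) e_out.
  by rewrite -dis.
(* The scales below N are skipped: their denominators may be less than N. *)
pose V n : set R := (\big[setU/set0]_(k <- iota N n) U k)%classic.
have mV n : measurable (V n) by apply: bigsetU_measurable.
have VS n : V n.+1 = (V n `|` U (N + n)%N)%classic.
  by rewrite /V -addn1 iotaD big_cat big_seq1.
have muV n : ((c * (ln (N + n).+1%:R - ln N.+1%:R))%:E <= lebesgue_measure (V n))%E.
  elim: n => [|n IHn]; first by rewrite addn0 subrr mulr0 measure_ge0.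
  have -> : lebesgue_measure (V n.+1)
      = (lebesgue_measure (V n) + lebesgue_measure (U (N + n)%N))%E.
    rewrite VS; apply: measureU; [exact: mV|exact: mU|].
    rewrite -subset0 => y [/mem_bigsetU[k kn yk] yU].
    move: kn; rewrite mem_iota => /andP[Nk kn].
    by rewrite -(disjU k _ Nk kn).
  apply: le_trans (leeD IHn (muU _)); rewrite -EFinD lee_fin -mulrDr (ler_pM2l c0).
  have := ln_succB_le R (N + n); rewrite addnS.
  by set t := _^-1; set u := ln (N + n).+2%:R; set v := ln (N + n).+1%:R; set w := ln _; lra.
have V02 n : (V n `<=` `]0, 2[)%classic.
  move=> y /mem_bigsetU[k _ /mem_bigsetU[x xs]].
  have [_ fr_k _ _] := sP k.
  have [p [q [_ /andP[q1 _] pq ->]]] := fr_k x xs.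
  have q0 : (0 : R) < q%:R by rewrite ltr0n (leq_ltn_trans _ q1).
  have x0 : 0 <= p%:R / q%:R :> R by rewrite divr_ge0.
  have x1 : p%:R / q%:R <= 1 :> R by rewrite ler_pdivrMr // mul1r ler_nat.
  rewrite /= !in_itv /= => /andP[y1 y2]; have := rho1 k.
  move: x0 x1 y1 y2; set x0 := _ / _; move=> *; lra.
have ln_bound n : c * (ln (N + n).+1%:R - ln N.+1%:R) <= 2.
  rewrite -lee_fin; apply: le_trans (muV n) _.
  rewrite -[X in (_ <= X%:E)%E]subr0 -lebesgue_measure_oo //.
  by apply: le_measure; rewrite ?inE; [exact: mV|exact: measurable_itv|exact: V02].
(* By ln_bound, ln (N + n + 1) never exceeds K. *)
pose K := 2 / c + ln N.+1%:R.
pose n := Num.truncn (expR K).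
have : K < ln (N + n).+1%:R.
  rewrite -ltr_expR lnK ?posrE ?ltr0n //.
  have /andP[_ /lt_le_trans] := truncn_itv (expR_ge0 K); apply.
  by rewrite ler_nat ltnS leq_addl.
have := ln_bound n; rewrite -ler_pdivlMl // mulrC /K.
by set u := ln (N + n).+1%:R; set v := ln _; set w := 2 / c; lra.
Qed.

(** * Upper and lower limits *)

Lemma limn_esup_ge_frequently (R : realType) (u : nat -> \bar R) (c : \bar R) :
  (forall N, exists2 n, (N <= n)%N & (c <= u n)%E) -> (c <= limn_esup u)%E.
Proof.
move=> freq; apply: le_ereal_inf_tmp => _ [V [N _ NV] <-].
have [n Nn cn] := freq N.
by apply: le_ereal_sup_tmp; exists (u n) => //; exists n => //; exact: NV.
Qed.

Lemma limn_einf_le_frequently (R : realType) (u : nat -> \bar R) (c : \bar R) :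
  (forall N, exists2 n, (N <= n)%N & (u n <= c)%E) -> (limn_einf u <= c)%E.
Proof.
move=> freq; rewrite /limn_einf leeNl; apply: limn_esup_ge_frequently => N.
by have [n Nn un] := freq N; exists n; rewrite //= leeN2.
Qed.

Theorem theorem9 (R : realType) :
  {ae @lebesgue_measure R, forall alpha : R,
    0 < alpha < 1 -> @irrational R alpha ->
    let u : nat -> \bar R := fun N : nat =>
      (trimmed_birkhoff_sum alpha (fun x : R => x^-1) N alpha
        / (N%:R * ln N%:R))%:E in
    (limn_esup u > 1)%E /\ (1 >= limn_einf u)%E}.
Proof.
have null : lebesgue_measure.-negligible (\bigcup_N never_log_close R 16 N)%classic.
  apply: negligible_bigcup => N.
  apply/negligibleP; first exact: measurable_never_log_close.
  by apply: never_log_close_null; rewrite ler_nat.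
apply: negligibleS null => x bad; apply: contrapT => often; apply: bad => x01 _.
have close N : exists p q : nat, [/\ coprime p q, (N <= q)%N &
    p%:R / q%:R < x < p%:R / q%:R + (16 * q%:R ^+ 2 * ln q%:R)^-1].
  apply: contrapT => none; apply: often; exists N => //; split.
    by case/andP: x01 => /ltW-> /ltW->.
  by move=> p q cpq Nq xpq; apply: none; exists p, q.
split.
  apply: (@lt_le_trans _ _ 2%:E); first by rewrite lte_fin ltr1n.
  apply: limn_esup_ge_frequently => N.
  have [p [q [_ Nq /andP[x1 x2]]]] := close (maxn N 2).
  move: Nq; rewrite geq_max => /andP[Nq q2].
  exists q.*2; first by rewrite -addnn (leq_trans Nq) // leq_addr.
  rewrite lee_fin (@trimmed_sum_ratio_ge2 R x p q) // subr_gt0 x1.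
  by rewrite ltrBlDl.
apply/lee_addgt0Pr => e e0; rewrite -EFinD.
apply: limn_einf_le_frequently => N.
(* The ratio is at most (1 + 1 / N) (1 + 1 / ln N); d bounds 1 / N and 1 / ln N,
   and M is large enough for this. *)
pose d := Num.min e 1 / 3.
have [d0 de] : 0 < d /\ (1 + d) * (1 + d) <= 1 + e.
  have [m0 me m1] : [/\ 0 < Num.min e 1, Num.min e 1 <= e & Num.min e 1 <= 1].
    by rewrite lt_min e0 ltr01 !ge_min !lexx orbT.
  rewrite /d; move: m0 me m1; set m := Num.min e 1 => m0 me m1; split; nra.
pose M := (Num.truncn (expR d^-1) + Num.truncn d^-1).+2.
have [p [q [cpq Nq /andP[x1 x2]]]] := close (maxn N M).+2.
case: q Nq cpq x1 x2 => [|[|n]] // Nn cpq x1 x2.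
move: Nn; rewrite !ltnS geq_max => /andP[Nn Mn].
exists n.+1; first exact: leqW.
have n0 : (0 : R) < n.+1%:R by rewrite ltr0n.
have truncn_lt_n y : 0 <= y -> (Num.truncn y <= n)%N -> y <= n.+1%:R :> R.
  move=> y0 yn; have /andP[_ /lt_le_trans yS] := truncn_itv y0.
  by apply/ltW/yS; rewrite ler_nat.
have {Mn} [Mexp Minv] : (Num.truncn (expR d^-1) <= n)%N /\ (Num.truncn d^-1 <= n)%N.
  by move: Mn; rewrite /M; move: (Num.truncn _) (Num.truncn _); clear; lia.
have inv_n : (n.+1%:R)^-1 <= d.
  rewrite -[leRHS]invrK lef_pV2 ?posrE ?invr_gt0 //.
  by apply: truncn_lt_n => //; rewrite invr_ge0 ltW.
have lnn : d^-1 <= ln n.+1%:R.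
  by rewrite -ler_expR lnK ?posrE //; apply: truncn_lt_n; rewrite ?expR_ge0.
have ln0 : (0 : R) < ln n.+1%:R by apply: lt_le_trans lnn; rewrite invr_gt0.
have inv_ln : (ln n.+1%:R)^-1 <= d by rewrite -[leRHS]invrK lef_pV2 ?posrE ?invr_gt0.
rewrite lee_fin; apply: le_trans de.
apply: (@le_trans _ _ ((1 + n.+1%:R^-1) * (1 + (ln n.+1%:R)^-1))); last first.
  by apply: ler_pM; rewrite ?lerD2l // addr_ge0 ?invr_ge0 ?(ltW ln0).
rewrite ler_pdivrMr ?mulr_gt0 //.
have xpn : 0 <= x - p%:R / n.+2%:R < (n.+2%:R ^+ 2)^-1.
  rewrite subr_ge0 (ltW x1) ltrBlDl; apply: lt_le_trans x2 _; rewrite lerD2l.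
  have lnq : 2^-1 <= ln n.+2%:R :> R by rewrite half_le_ln.
  have q2 : 0 < n.+2%:R ^+ 2 :> R by rewrite exprn_gt0.
  rewrite lef_pV2 ?posrE ?mulr_gt0 //; last by apply: lt_le_trans lnq; rewrite invr_gt0.
  rewrite mulrAC; apply: ler_peMl; first exact: ltW.
  by move: lnq; set t := ln _; lra.
apply: le_trans (trimmed_sum_le R x p n x01 cpq xpn) _.
have -> : n.+2%:R = n.+1%:R + 1 :> R by rewrite natr1.
rewrite le_eqVlt; apply/orP; left; apply/eqP.
move: n0 ln0; set t := n.+1%:R; set v := ln _ => t0 v0.
by field; rewrite !gt_eqF.
Qed.
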